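(* Let $K$ be a field (of arbitrary characteristic), $n\ge 1$, $X=(X_1,\ldots,X_n)$, and let $F=(F_1,\ldots,F_n)\in K[[X]]^n$ be such that $F(0)=0$ and $F(X)=X+H(X)$, where $H=(H_1,\ldots,H_n)$ and the order of vanishing $t_i=\operatorname{ord}(H_i)$ of each $H_i$ is strictly greater than one. Let $t=\min_i t_i$. Assume that the formal inverse $G=(G_1,\ldots,G_n)=F^{-1}$ is a polynomial mapping of degree $D$. Let $(P_k)_{k\ge 0}$, $P_k=(P_k^1,\ldots,P_k^n)\in K[[X]]^n$, be the sequence defined by $P_0^i(X)=X_i$ and $P_{k+1}^i=P_k^i\circ F-P_k^i$ for $k\ge 0$ and $i=1,\ldots,n$. Then the following hold. 1) For $i=1,\ldots,n$ and $\mu_i=\left\lfloor \frac{D-t_i}{t-1}+1\right\rfloor+1$, for every integer $m\ge \mu_i$ we have $$\sum_{k=0}^{m-1}(-1)^kP_k^i(X)=G_i(X)+R_m^i(X),$$ where $G_i(X)$ is a polynomial of degree $\le D$ independent of $m$, and $R_m^i(X)\in K[[X]]$ satisfies $R_m^i(F)=(-1)^{m+1}P_m^i(X)$. 2) Moreover, the inverse $G$ of $F$ is given by $$G_i(Y_1,\ldots,Y_n)=\sum_{k=0}^{m-1}(-1)^k\widetilde{P_k^i}^D(Y_1,\ldots,Y_n),\qquad i=1,\ldots,n,$$ where $\widetilde{P_k^i}^D$ is the sum of the homogeneous summands of $P_k^i$ of degree $\le D$ and $m$ is any integer greater than $\frac{D-t_i}{t-1}+1$.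
   Context: $K[[X]]$ is the ring of formal power series in $X_1,\ldots,X_n$ over $K$. For $\Phi\in K[[X]]$ with decomposition $\Phi=\sum_{q\ge 0}\Phi_q$ into homogeneous components ($\Phi_q$ homogeneous of degree $q$), the order of vanishing is $\operatorname{ord}(\Phi)=\min\{q:\Phi_q\ne 0\}$ for $\Phi\neq 0$, and $\operatorname{ord}(0)=\infty$. For $\Phi\in K[[X]]$, $\Phi\circ F=\Phi(F)=\Phi(F_1,\ldots,F_n)$ (well defined since $F(0)=0$). The formal inverse $G$ of $F$ is the unique $G\in K[[X]]^n$ with $G(0)=0$ and $G\circ F(X)=X$; it also satisfies $F\circ G(X)=X$. A polynomial mapping of degree $D$ is a tuple $G=(G_1,\ldots,G_n)$ of polynomials with $\max_i\deg G_i=D$. $\lfloor\cdot\rfloor$ is the floor function. *)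

(* Defs.v *)
From HB Require Import structures.
From mathcomp Require Import all_boot all_order all_algebra.
From mathcomp Require Import boolp.
From mathcomp Require Export mpoly.

Set Implicit Arguments.
Unset Strict Implicit.
Unset Printing Implicit Defensive.

Import GRing.Theory.

Local Open Scope ring_scope.

(* Formal power series in n variables, given by their coefficient functions;
   the exponents are the multinomials ['X_{1..n}] of [mpoly]. *)
Record ps (n : nat) (R : Type) := MkPs { coefps :> 'X_{1..n} -> R }.

Section PowerSeriesRing.
Variables (n : nat) (R : comNzRingType).
Implicit Types (f g h : ps n R) (m : 'X_{1..n}).

HB.instance Definition _ := gen_eqMixin (ps n R).
HB.instance Definition _ := gen_choiceMixin (ps n R).

Lemma psP f g : (forall m, f m = g m) <-> f = g.
Proof.
split=> [|-> //]; case: f g => [f] [g] /= fg.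
by congr MkPs; apply/funext.
Qed.

Definition ps_zero : ps n R := MkPs (fun _ => 0).
Definition ps_opp f := MkPs (fun m => - f m).
Definition ps_add f g := MkPs (fun m => f m + g m).

Fact ps_addA : associative ps_add.
Proof. by move=> f g h; apply/psP=> m /=; rewrite addrA. Qed.
Fact ps_addC : commutative ps_add.
Proof. by move=> f g; apply/psP=> m /=; rewrite addrC. Qed.
Fact ps_add0 : left_id ps_zero ps_add.
Proof. by move=> f; apply/psP=> m /=; rewrite add0r. Qed.
Fact ps_addN : left_inverse ps_zero ps_opp ps_add.
Proof. by move=> f; apply/psP=> m /=; rewrite addNr. Qed.

HB.instance Definition _ :=
  GRing.isZmodule.Build (ps n R) ps_addA ps_addC ps_add0 ps_addN.

(* Cauchy product; same shape as [mcoeffM]. *)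
Definition ps_mul f g := MkPs (fun m =>
  \sum_(k : 'X_{1..n < (mdeg m).+1, (mdeg m).+1} | m == (k.1 + k.2)%MM)
    f k.1 * g k.2).

Lemma ps_mulE f g m : ps_mul f g m =
  \sum_(k : 'X_{1..n < (mdeg m).+1, (mdeg m).+1} | m == (k.1 + k.2)%MM)
    f k.1 * g k.2.
Proof. by []. Qed.

Definition ps_of_mpoly (p : {mpoly R[n]}) : ps n R := MkPs (fun m => p@_m).

Definition mpoly_trunc (b : nat) f : {mpoly R[n]} :=
  \sum_(m : 'X_{1..n < b}) f m *: 'X_[m].

Lemma mcoeff_trunc b f m : (mdeg m < b)%N -> (mpoly_trunc b f)@_m = f m.
Proof. exact: (@mcoeff_mpoly n R f). Qed.

Lemma ps_mul_trunc b f g m : (mdeg m < b)%N ->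
  ps_mul f g m = (mpoly_trunc b f * mpoly_trunc b g)@_m.
Proof.
move=> lt_mb; rewrite mcoeffM /=; apply: eq_bigr => k _.
by rewrite !mcoeff_trunc // (leq_trans (bmdeg _)).
Qed.

Fact ps_mulA : associative ps_mul.
Proof.
move=> f g h; apply/psP=> m.
transitivity ((mpoly_trunc (mdeg m).+1 f *
  (mpoly_trunc (mdeg m).+1 g * mpoly_trunc (mdeg m).+1 h))@_m).
  rewrite mcoeffM [LHS]ps_mulE; apply: eq_bigr => k _.
  by rewrite mcoeff_trunc ?bmdeg // (ps_mul_trunc _ _ (bmdeg _)).
rewrite mulrA mcoeffM [RHS]ps_mulE; apply: eq_bigr => k _.
by rewrite mcoeff_trunc ?bmdeg // (ps_mul_trunc _ _ (bmdeg _)).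
Qed.

Fact ps_mulC : commutative ps_mul.
Proof.
by move=> f g; apply/psP=> m; rewrite !(ps_mul_trunc _ _ (ltnSn _)) mulrC.
Qed.

Fact ps_mul1 : left_id (ps_of_mpoly 1) ps_mul.
Proof.
move=> f; apply/psP=> m; rewrite -[RHS](mcoeff_trunc f (ltnSn (mdeg m))).
rewrite -[X in _ = mcoeff _ X]mul1r mcoeffM /=; apply: eq_bigr => k _.
by rewrite mcoeff_trunc ?bmdeg.
Qed.

Fact ps_mulDl : left_distributive ps_mul ps_add.
Proof.
move=> f g h; apply/psP=> m /=; rewrite -big_split /=.
by apply: eq_bigr => k _; rewrite mulrDl.
Qed.

Fact ps_1neq0 : ps_of_mpoly 1 != 0.
Proof.
apply/eqP=> /psP/(_ 0%MM) /= /eqP.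
by rewrite mcoeff1 eqxx oner_eq0.
Qed.

HB.instance Definition _ := GRing.Zmodule_isComNzRing.Build (ps n R)
  ps_mulA ps_mulC ps_mul1 ps_mulDl ps_1neq0.

Lemma coefps0 m : (0 : ps n R) m = 0. Proof. by []. Qed.
Lemma coefpsD f g m : (f + g) m = f m + g m. Proof. by []. Qed.
Lemma coefpsN f m : (- f) m = - f m. Proof. by []. Qed.
Lemma coefpsB f g m : (f - g) m = f m - g m. Proof. by []. Qed.
Lemma coefpsM f g m : (f * g) m =
  \sum_(k : 'X_{1..n < (mdeg m).+1, (mdeg m).+1} | m == (k.1 + k.2)%MM)
    f k.1 * g k.2.
Proof. by []. Qed.

Fact ps_of_mpoly_is_zmod_morphism : zmod_morphism ps_of_mpoly.
Proof. by move=> p q; apply/psP=> m /=; rewrite mcoeffB. Qed.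

Fact ps_of_mpoly_is_monoid_morphism : monoid_morphism ps_of_mpoly.
Proof. by split=> // p q; apply/psP=> m /=; rewrite mcoeffM. Qed.

HB.instance Definition _ :=
  GRing.isZmodMorphism.Build {mpoly R[n]} (ps n R) ps_of_mpoly
    ps_of_mpoly_is_zmod_morphism.
HB.instance Definition _ :=
  GRing.isMonoidMorphism.Build {mpoly R[n]} (ps n R) ps_of_mpoly
    ps_of_mpoly_is_monoid_morphism.

End PowerSeriesRing.

Section Composition.
Variables (n : nat) (R : comNzRingType).
Implicit Types (f : ps n R) (F G H : 'I_n -> ps n R) (m : 'X_{1..n}).

Definition psX (i : 'I_n) : ps n R := ps_of_mpoly 'X_i.

(* When F(0) = 0, the product over i has order at least [mdeg d], so that the
   exponents d with [mdeg d > mdeg m] contribute nothing to the coefficient of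
   m in the substitution f(F). The definition is meaningful only in that
   case. *)
Definition ps_comp f F : ps n R := MkPs (fun m =>
  \sum_(d : 'X_{1..n < (mdeg m).+1}) f d * (\prod_(i < n) F i ^+ d i) m).

Definition formal_inverse F G : Prop :=
  (forall i, G i 0%MM = 0) /\ (forall i, ps_comp (G i) F = psX i).

Definition polynomial_mapping G (D : nat) : Prop :=
  exists g : 'I_n -> {mpoly R[n]},
    (forall i, G i = ps_of_mpoly (g i)) /\
    (\max_(i < n) (msize (g i)).-1)%N = D.

Fixpoint Pseq F (k : nat) (i : 'I_n) : ps n R :=
  if k is k'.+1 then ps_comp (Pseq F k' i) F - Pseq F k' i else psX i.

End Composition.

Section Order.
Variables (n : nat) (R : comNzRingType).
Implicit Types f : ps n R.

Definition hcomp (q : nat) f : ps n R :=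
  MkPs (fun m => if mdeg m == q then f m else 0).

Definition ps_trunc (D : nat) f : ps n R := \sum_(q < D.+1) hcomp q f.

Lemma hcomp_neq0 f : f <> 0 -> exists q, hcomp q f != 0.
Proof.
move=> fN0; apply/not_existsP => f0; apply/fN0/psP => m.
have /negP/negPn/eqP/psP/(_ m) := f0 (mdeg m).
by rewrite /= eqxx.
Qed.

(* [None] is the order of the zero series, infinity. *)
Definition ps_ord f : option nat :=
  if f =P 0 is ReflectF fN0 then Some (ex_minn (hcomp_neq0 fN0)) else None.

Lemma ps_ord_None f : ps_ord f = None <-> f = 0.
Proof. by rewrite /ps_ord; case: eqP => // ?; split. Qed.

Lemma ps_ord_Some f q : ps_ord f = Some q <->
  hcomp q f != 0 /\ (forall p, (p < q)%N -> hcomp p f = 0).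
Proof.
rewrite /ps_ord; case: eqP => [f0|fN0]; split=> //.
- case=> /eqP[]; apply/psP=> m /=; rewrite f0.
  by case: ifP.
- case: ex_minnP => q' hq' minq' [<-]; split=> // p lt_pq'.
  by apply/eqP; apply: contraTT lt_pq' => /minq'; rewrite -leqNgt.
- case=> hq minq; congr Some; case: ex_minnP => q' hq' minq'.
  apply/eqP; rewrite eqn_leq minq' // leqNgt.
  by apply/negP => /minq /eqP; apply/negP.
Qed.

End Order.

(* Orders are elements of [option nat], [None] being infinity. *)
Definition lt_order (q : nat) (t : option nat) : bool :=
  if t is Some a then (q < a)%N else true.

Definition min_order (s t : option nat) : option nat :=
  match s, t with
  | Some a, Some b => Some (minn a b)
  | Some a, None => Some a
  | None, _ => t
  end.

(* (D - ti) / (t - 1) + 1, where t is the minimum of the ti. If ti is infinite,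
   the bound is minus infinity, encoded as [None]. An infinite t forces an
   infinite ti, so the pair (Some _, None) does not occur. *)
Definition bound (D : nat) (ti t : option nat) : option rat :=
  match ti, t with
  | Some a, Some b => Some ((D%:R - a%:R) / (b%:R - 1) + 1)
  | Some _, None | None, _ => None
  end.

Definition mu (D : nat) (ti t : option nat) : option int :=
  omap (fun x : rat => Num.floor x + 1) (bound D ti t).

(* Main.v *)
(* Write s(f) = f(F), so that P_k = (s - 1)^k X_i. Telescoping gives
   s(sum_(k < m) (-1)^k P_k) = X_i + (-1)^(m+1) P_m, and subtracting
   s(G_i) = X_i yields the first part. As F = X + H with H of order t > 1, the
   operator s - 1 raises orders by at least t - 1; hence P_m has order at least
   t_i + (m - 1)(t - 1), and s preserves orders, so that the remainder R_m has
   order greater than D as soon as m > (D - t_i)/(t - 1) + 1. *)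
Require Import Defs.
From mathcomp Require Import all_boot all_order all_algebra.
From mathcomp Require Import zify.

Set Implicit Arguments.
Unset Strict Implicit.
Unset Printing Implicit Defensive.

Import Order.TTheory GRing.Theory Num.Theory.

Local Open Scope ring_scope.

(** * Filtration of power series by order of vanishing *)

Section OrderFiltration.
Variables (n : nat) (R : comNzRingType).
Implicit Types (f g : ps n R) (m : 'X_{1..n}) (F : 'I_n -> ps n R).

(** Lower bounds on the order, stated on coefficients so that the zero series needs no separate
    case. *)
Definition ord_ge (q : nat) f := forall m, (mdeg m < q)%N -> f m = 0.

Lemma lt_orderP q f : lt_order q (ps_ord f) <-> ord_ge q.+1 f.
Proof.
split=> [|fq].
  case E: (ps_ord f) => [a|] /= lt_qa m lt_mq; last first.
    by move/ps_ord_None: E => ->.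
  case/ps_ord_Some: E => _ /(_ (mdeg m) (leq_trans lt_mq lt_qa)) /psP/(_ m) /=.
  by rewrite eqxx.
case E: (ps_ord f) => [a|] //=; case/ps_ord_Some: E => /eqP fa _.
rewrite ltnNge; apply/negP=> le_aq; apply: fa; apply/psP=> m /=.
by case: eqP => // ma; apply: fq; rewrite ma.
Qed.

Lemma ord_geW p q f : (p <= q)%N -> ord_ge q f -> ord_ge p f.
Proof. by move=> le_pq fq m lt_mp; apply: fq; apply: leq_trans le_pq. Qed.

Lemma ord_geD q f g : ord_ge q f -> ord_ge q g -> ord_ge q (f + g).
Proof. by move=> fq gq m mq; rewrite coefpsD fq // gq // addr0. Qed.

Lemma ord_geM p q f g : ord_ge p f -> ord_ge q g -> ord_ge (p + q) (f * g).
Proof.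
move=> fp gq m lt_m; rewrite coefpsM big1 // => k /eqP mE.
have: (mdeg k.1 + mdeg k.2 < p + q)%N by rewrite -mdegD -mE.
have [/fp-> _|le_p] := ltnP (mdeg k.1) p; first by rewrite mul0r.
move=> lt_k; rewrite gq ?mulr0 // -(ltn_add2l p).
by apply: leq_ltn_trans lt_k; rewrite leq_add2r.
Qed.

Lemma coefps_sum (I : Type) (r : seq I) (P : pred I) (f : I -> ps n R) m :
  (\sum_(i <- r | P i) f i) m = \sum_(i <- r | P i) f i m.
Proof. by elim/big_rec2: _ => [//|i x y _ <-]; rewrite coefpsD. Qed.

Lemma coefps_signM k f m : ((-1) ^+ k * f) m = (-1) ^+ k * f m.
Proof. by rewrite -signr_odd -[in RHS]signr_odd !mulr_sign; case: odd. Qed.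

Lemma coefps_trunc D f m : ps_trunc D f m = if (mdeg m <= D)%N then f m else 0.
Proof.
rewrite /ps_trunc coefps_sum /=; case: leqP => [lt_mD|lt_Dm].
  rewrite (bigD1 (Ordinal (lt_mD : (mdeg m < D.+1)%N))) //= eqxx big1 ?addr0 // => q /eqP neq_q.
  by case: eqP => // mq; case: neq_q; apply: val_inj.
by rewrite big1 // => q _; case: eqP => // mq; have := ltn_ord q; lia.
Qed.

Lemma coef_psX i m : psX R i m = (m == U_(i)%MM)%:R.
Proof. by rewrite /psX /= mcoeffX eq_sym. Qed.

Lemma psX_prod (d : 'X_{1..n}) :
  \prod_(i < n) psX R i ^+ d i = ps_of_mpoly 'X_[d].
Proof.
rewrite mpolyXE_id rmorph_prod; apply: eq_bigr => i _.
by rewrite rmorphXn.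
Qed.

End OrderFiltration.

(** * Substitution as an additive operator *)

Section Substitution.
Variables (n : nat) (R : comNzRingType).
Implicit Types (f g : ps n R) (m : 'X_{1..n}).

Lemma ps_comp0 (F : 'I_n -> ps n R) : ps_comp 0 F = 0.
Proof. by apply/psP=> m /=; rewrite big1 // => d _; rewrite mul0r. Qed.

Lemma ps_compD (F : 'I_n -> ps n R) f g :
  ps_comp (f + g) F = ps_comp f F + ps_comp g F.
Proof.
by apply/psP=> m /=; rewrite -big_split; apply: eq_bigr => d _ /=; rewrite mulrDl.
Qed.

Lemma ps_compN (F : 'I_n -> ps n R) f : ps_comp (- f) F = - ps_comp f F.
Proof.
by apply/psP=> m /=; rewrite -sumrN; apply: eq_bigr => d _ /=; rewrite mulNr.
Qed.

Lemma ps_comp_signM (F : 'I_n -> ps n R) k f :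
  ps_comp ((-1) ^+ k * f) F = (-1) ^+ k * ps_comp f F.
Proof.
by rewrite -signr_odd !mulr_sign; case: odd; rewrite ?ps_compN.
Qed.

Lemma ps_comp_psX (F : 'I_n -> ps n R) i : F i 0%MM = 0 -> ps_comp (psX R i) F = F i.
Proof.
move=> Fi0; apply/psP=> m /=.
have prodU : \prod_(j < n) F j ^+ U_(i)%MM j = F i.
  rewrite (bigD1 i) //= mnm1E eqxx expr1 big1 ?mulr1 // => j /negPf neq_ji.
  by rewrite mnm1E eq_sym neq_ji expr0.
(* In degree 0 the truncated sum defining the composition misses [U_(i)]; its value 0 is right
   because [F i] has no constant term. *)
have [m0|m_gt0] := posnP (mdeg m).
  move/eqP: m0; rewrite mdeg_eq0 => /eqP->; rewrite Fi0 big1 // => d _.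
  rewrite mcoeffX; case: eqP => [dU|_]; last by rewrite mul0r.
  by have := bmdeg d; rewrite -dU mdeg1 mdeg0.
have ltU : (mdeg U_(i)%MM < (mdeg m).+1)%N by rewrite mdeg1.
rewrite (bigD1 (BMultinom ltU)) //= mcoeffX eqxx mul1r prodU big1 ?addr0 // => d.
move=> neq_d; rewrite mcoeffX; case: eqP => [dU|_]; last by rewrite mul0r.
by case/eqP: neq_d; apply: val_inj.
Qed.

Lemma Pseq_telescope (F : 'I_n -> ps n R) i (m : nat) : F i 0%MM = 0 ->
  ps_comp (\sum_(0 <= k < m) (-1) ^+ k * Pseq F k i) F
  = psX R i + (-1) ^+ m.+1 * Pseq F m i.
Proof.
move=> Fi0; elim: m => [|m IHm].
  by rewrite big_geq // ps_comp0 expr1 mulN1r subrr.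
rewrite big_nat_recr //= ps_compD IHm ps_comp_signM !exprS !mulN1r !opprK.
by rewrite mulrBr mulNr addrAC -addrA.
Qed.

End Substitution.

(** * Substitution of a map tangent to the identity; [s] stands for t - 1 *)

Section TangentToIdentity.
Variables (n : nat) (R : comNzRingType) (F H : 'I_n -> ps n R) (s : nat).
Hypothesis FE : forall i, F i = psX R i + H i.
Hypothesis H_ge : forall i, ord_ge s.+1 (H i).
Implicit Types (f g : ps n R) (m d : 'X_{1..n}).

(** Agreement of [f] and [g] for [s] degrees beyond [q]. The bounds on [f] and [g] themselves make
    the relation multiplicative. *)
Definition close q f g := [/\ ord_ge q f, ord_ge q g & ord_ge (q + s) (f - g)].

Lemma close1 : close 0 1 1.
Proof. by split=> // m _; rewrite subrr. Qed.

Lemma closeM p q f f' g g' :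
  close p f f' -> close q g g' -> close (p + q) (f * g) (f' * g').
Proof.
case=> fp f'p ff' [gq g'q gg']; split; [exact: ord_geM | exact: ord_geM |].
have ->: f * g - f' * g' = f * (g - g') + (f - f') * g'.
  by rewrite mulrBr mulrBl addrA subrK.
apply: ord_geD; first by rewrite -addnA; apply: ord_geM.
by rewrite addnAC; apply: ord_geM.
Qed.

Lemma closeX q f g k : close q f g -> close (k * q) (f ^+ k) (g ^+ k).
Proof.
move=> fg; elim: k => [|k IHk]; first by rewrite mul0n !expr0; exact: close1.
by rewrite mulSn !exprS; apply: closeM.
Qed.

Lemma close_psX i : close 1 (F i) (psX R i).
Proof.
have X1 : ord_ge 1 (psX R i).
  move=> m; rewrite ltnS leqn0 mdeg_eq0 => /eqP->.
  by rewrite coef_psX -[_ == _]/(0%MM == _) eq_sym -mdeg_eq0 mdeg1.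
split=> //; rewrite FE; first by apply: ord_geD => //; apply: ord_geW (H_ge i).
by rewrite addrAC subrr add0r add1n.
Qed.

Lemma close_prod d :
  close (mdeg d) (\prod_(i < n) F i ^+ d i) (ps_of_mpoly 'X_[d]).
Proof.
rewrite -psX_prod mdegE.
elim/big_ind3: _ => [|p f f' q g g'|i _]; [exact: close1 | exact: closeM |].
by rewrite -[X in close X]muln1; apply: closeX; apply: close_psX.
Qed.

(** Writing [f] as the sum of its terms [f d] X^d puts both series over the same index set, so that
    F^d and X^d can be compared one exponent at a time. *)
Lemma coef_ps_comp f m : (ps_comp f F - f) m =
  \sum_(d : 'X_{1..n < (mdeg m).+1})
    f d * (\prod_(i < n) F i ^+ d i - ps_of_mpoly 'X_[d]) m.
Proof.
under eq_bigr do rewrite coefpsB mulrBr.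
rewrite sumrB coefpsB /=; congr (_ - _).
rewrite (bigD1 (BMultinom (ltnSn (mdeg m)))) //= mcoeffX eqxx mulr1.
rewrite big1 ?addr0 // => d neq_d; rewrite mcoeffX; case: eqP => [dm|_].
  by case/eqP: neq_d; apply: val_inj.
by rewrite mulr0.
Qed.

Lemma ord_ge_compB q f : ord_ge q f -> ord_ge (q + s) (ps_comp f F - f).
Proof.
move=> fq m lt_m; rewrite coef_ps_comp big1 // => d _.
(* Low exponents are killed by [f d]; for the others F^d - X^d has order at least [mdeg d + s]. *)
have [/fq->|le_qd] := ltnP (mdeg d) q; first by rewrite mul0r.
by have [_ _ ->] := close_prod d; rewrite ?mulr0 //; lia.
Qed.

(** In degree [q], [f] and f(F) agree once [f] has order at least [q], since their difference has
    order at least [q + s]; so the bound climbs one degree at a time. *)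
Lemma ord_ge_comp q f : (0 < s)%N -> ord_ge q (ps_comp f F) -> ord_ge q f.
Proof.
move=> s_gt0; elim: q => // q IHq fFq.
have fq : ord_ge q f by apply: IHq; apply: ord_geW fFq.
move=> m lt_m; have := ord_ge_compB fq; move/(_ m).
by rewrite coefpsB fFq // sub0r => /(_ _)/eqP; rewrite oppr_eq0 => fm; apply/eqP/fm; lia.
Qed.

Hypothesis F0 : forall i, F i 0%MM = 0.

(** The count starts at P_1, which is [H i]. *)
Lemma ord_ge_Pseq a i k : ord_ge a (H i) -> ord_ge (a + k * s) (Pseq F k.+1 i).
Proof.
move=> Ha; elim: k => [|k IHk].
  by rewrite addn0 [Pseq _ _ _]/= ps_comp_psX // FE addrAC subrr add0r.
by rewrite mulSn addnCA addnC; apply: ord_ge_compB.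
Qed.

(** The truncated formula for m = [k.+1], with the bound on m cleared of denominators. *)
Lemma inverse_Pseq_trunc G a D i k (g : {mpoly R[n]}) : (0 < s)%N ->
  formal_inverse F G -> G i = ps_of_mpoly g -> (msize g <= D.+1)%N ->
  ord_ge a (H i) -> (D < a + k * s)%N ->
  G i = \sum_(0 <= j < k.+1) (-1) ^+ j * ps_trunc D (Pseq F j i).
Proof.
move=> s_gt0 [_ GF] Gg le_gD Ha lt_D; apply/psP=> m.
rewrite coefps_sum; under eq_bigr do rewrite coefps_signM coefps_trunc.
case: leqP => [le_mD|lt_Dm]; last first.
  rewrite big1 => [|j _]; last by rewrite mulr0.
  by rewrite Gg; apply/memN_msupp_eq0/msize_mdeg_ge/(leq_trans le_gD).
under eq_bigr do rewrite -coefps_signM.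
set S := \sum_(0 <= j < k.+1) (-1) ^+ j * Pseq F j i.
(* After substitution of [F] the remainder is P_{k+1} up to sign, of order at least [a + k * s]. *)
have remainder_ge : ord_ge D.+1 (S - G i).
  apply: ord_ge_comp => // d lt_d.
  rewrite ps_compD ps_compN GF Pseq_telescope // addrAC subrr add0r coefps_signM.
  by rewrite (ord_ge_Pseq (k := k) Ha) ?mulr0 //; lia.
rewrite -coefps_sum; apply/esym/eqP; rewrite -subr_eq0 -coefpsB; apply/eqP.
exact: remainder_ge.
Qed.

End TangentToIdentity.

Lemma lt_order_min q s t : lt_order q (min_order s t) = lt_order q s && lt_order q t.
Proof. by case: s t => [a|] [b|] //=; rewrite ?andbT // leq_min. Qed.

(** Determines t through its strict lower bounds, without choosing an index that attains the
    minimum. *)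
Lemma lt_order_bigmin q n (u : 'I_n -> option nat) :
  lt_order q (\big[min_order/None]_(i < n) u i) = [forall i, lt_order q (u i)].
Proof.
rewrite (big_morph _ (lt_order_min q) (erefl : lt_order q None = true)).
exact: big_andE.
Qed.

(* An order ti is None when H i = 0; then mu and bound are None, i.e. minus
   infinity, and the corresponding inequality on m is void. In the second part
   m is nevertheless a positive integer, a condition which is automatic when
   the bound is finite. *)
Theorem corollary4p1 (K : fieldType) (n : nat) (hn : (0 < n)%N)
    (F H : 'I_n -> ps n K)
    (hF0 : forall i, F i 0%MM = 0)
    (hFH : forall i, F i = psX K i + H i)
    (hord : forall i, lt_order 1 (ps_ord (H i)))
    (t : option nat)
    (ht : t = \big[min_order/None]_(i < n) ps_ord (H i))
    (G : 'I_n -> ps n K) (hG : formal_inverse F G)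
    (D : nat) (hD : polynomial_mapping G D) :
  (forall i : 'I_n,
     (exists2 g : {mpoly K[n]}, G i = ps_of_mpoly g & (msize g <= D.+1)%N) /\
     (forall m : nat,
        (if mu D (ps_ord (H i)) t is Some z then z <= m%:Z else true) ->
        exists R : ps n K,
          \sum_(0 <= k < m) (-1) ^+ k * Pseq F k i = G i + R /\
          ps_comp R F = (-1) ^+ m.+1 * Pseq F m i)) /\
  (forall i : 'I_n, forall m : nat,
     (if bound D (ps_ord (H i)) t is Some x then x < m%:R else (0 < m)%N) ->
     G i = \sum_(0 <= k < m) (-1) ^+ k * ps_trunc D (Pseq F k i)).
Proof.
have [g [Gg degg]] := hD.
have size_g i : (msize (g i) <= D.+1)%N.
  have := leq_bigmax i (F := fun i => (msize (g i)).-1); rewrite degg; lia.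
split=> i.
  split=> [|m _]; first by exists (g i).
  exists (\sum_(0 <= k < m) (-1) ^+ k * Pseq F k i - G i).
  split; first by rewrite addrC subrK.
  by rewrite ps_compD ps_compN hG.2 Pseq_telescope // addrAC subrr add0r.
have Gtrunc s a k (Hs : forall j, ord_ge s.+1 (H j)) :=
  @inverse_Pseq_trunc n K F H s hFH Hs hF0 G a D i k (g i).
move=> m; case ui: (ps_ord (H i)) => [a|] /=; last first.
  move/ps_ord_None: ui => Hi0; case: m => // k _.
  (* As [H i] is zero, any [a] bounds its order from below; [D.+1] makes the inequality hold for
     every [k]. *)
  apply: (Gtrunc 1%N D.+1) => //; last by lia.
    by move=> j; apply/lt_orderP.
  by rewrite Hi0.
have Ha : ord_ge a (H i).
  by case: (a) ui => // a' ui; apply/lt_orderP; rewrite ui /=.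
have lt_ot q : lt_order q t = [forall j, lt_order q (ps_ord (H j))].
  by rewrite ht; apply: lt_order_bigmin.
case tE: t lt_ot => [b|] lt_ot; last first.
  (* An infinite t would give [a < a]. *)
  by have /esym/forallP/(_ i) := lt_ot a; rewrite ui /= ltnn.
have b_gt1 : (1 < b)%N.
  by rewrite -[(1 < b)%N]/(lt_order 1 (Some b)) lt_ot; apply/forallP.
case: b b_gt1 lt_ot {tE} => // s; rewrite ltnS => s_gt0 lt_ot.
have Hs j : ord_ge s.+1 (H j).
  by apply/lt_orderP; have := lt_ot s; rewrite /= ltnSn => /esym/forallP.
have sR_gt0 : 0 < s%:R :> rat by rewrite ltr0n.
(* For m = [k.+1] the bound reads [D < a + k * s]. *)
rewrite -natr1 addrK; case: m => [|k]; last first.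
  rewrite -natr1 ltrD2r ltr_pdivrMr // ltrBlDl -natrM -natrD ltr_nat => lt_D.
  exact: (Gtrunc s a k).
(* For m = 0 the sum is empty and the bound is contradictory: it forces [D < a], so the case [k = 0]
   makes [G i] the truncation of X_i. *)
rewrite -ltrBrDr sub0r ltr_pdivrMr // mulN1r => lt_D.
have lt_Da : (D < a + 0 * s)%N.
  by rewrite addn0 -(ltr_nat rat) -subr_lt0 (lt_trans lt_D) ?oppr_lt0.
have := Gtrunc s a 0%N Hs s_gt0 hG (Gg i) (size_g i) Ha lt_Da.
rewrite big_nat1 expr0 mul1r => GX; have GXF := hG.2 i.
have [D0|D_gt0] := posnP D.
  have G0 : G i = 0.
    apply/psP=> m; rewrite GX coefps_trunc D0 leqn0 mdeg_eq0 coef_psX.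
    case: eqP => // ->; case: eqP => // /(congr1 (@mdeg n)).
    by rewrite mdeg0 mdeg1.
  move: GXF; rewrite G0 ps_comp0 => /psP/(_ U_(i)%MM)/eqP.
  by rewrite coef_psX eqxx eq_sym oner_eq0.
(* Now G_i = X_i gives F_i = X_i, hence [H i = 0], against its finite order. *)
have GX' : G i = psX K i.
  apply/psP=> m; rewrite GX coefps_trunc coef_psX.
  by case: leqP => //; case: eqP => // ->; rewrite mdeg1 ltnNge D_gt0.
move: GXF; rewrite GX' ps_comp_psX // hFH => /(congr1 (fun f => f - psX K i)).
by rewrite addrAC subrr add0r => /ps_ord_None; rewrite ui.
Qed.
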